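(* (1) Let $\mathcal{A}=(A,1,0,\vee,\wedge,\rightarrow,\neg,\sim)$ be a ccpBa (respectively, a c$\vee$cpBa). Let $X_A$ be the set of prime filters of $\mathcal{A}$, $\sigma(a)=\{P\in X_A : a\in P\}$ for $a\in A$, $\tau_{\mathcal{A}}$ the topology on $X_A$ generated by the subbasis $\{\sigma(a): a\in A\}\cup\{X_A\setminus\sigma(a): a\in A\}$, and $Y_0:=\sigma(\sim 1)$. Then: (a) $(X_A,\tau_{\mathcal{A}},\subseteq)$ is an Esakia space, and $Y_0$ is a clopen set in $\tau_{\mathcal{A}}$ satisfying $$\forall x\in X_A\,\bigl(\forall y\in X_A\,(x\subseteq y\Rightarrow\exists z\in X_A\,(y\subseteq z\ \&\ z\in Y_0))\Rightarrow x\in Y_0\bigr)$$ (respectively, this condition and also $\forall x,y\in X_A\,(x,y\notin Y_0\Rightarrow(x\subseteq y\Rightarrow y\subseteq x))$). (b) $\mathcal{D}(X_A):=(CpUp(X_A),X_A,\emptyset,\cup,\cap,\rightarrow,\neg,\sim)$ is a ccpBa (respectively, a c$\vee$cpBa). (c) The map $\Phi:A\to CpUp(X_A)$, $\Phi(a):=\sigma(a)$, is an isomorphism from $\mathcal{A}$ onto $\mathcal{D}(X_A)$. (2) Let $(X,\tau,\leq)$ be an Esakia space and $Y_0\subseteq X$ a clopen upset satisfying $$\forall x\in X\,\bigl(\forall y\in X\,(x\leq y\Rightarrow\exists z\in X\,(y\leq z\ \&\ z\in Y_0))\Rightarrow x\in Y_0\bigr)$$ (respectively, this condition and also $\forall x,y\in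 X\,(x,y\notin Y_0\Rightarrow(x\leq y\Rightarrow y\leq x))$). Then: (a) $\mathcal{D}(X):=(CpUp(X),X,\emptyset,\cup,\cap,\rightarrow,\neg,\sim)$ is a ccpBa (respectively, a c$\vee$cpBa). (b) $(X_{CpUp(X)},\tau_{\mathcal{D}(X)},\subseteq)$ is an Esakia space. Moreover, the set $\widetilde{Y_0}$ of all prime filters of $\mathcal{D}(X)$ containing $\sim X$ satisfies $$\forall x\in X_{CpUp(X)}\,\bigl(\forall y\in X_{CpUp(X)}\,(x\subseteq y\Rightarrow\exists z\in X_{CpUp(X)}\,(y\subseteq z\ \&\ z\in\widetilde{Y_0}))\Rightarrow x\in\widetilde{Y_0}\bigr);$$ and if $Y_0$ satisfies $\forall x,y\in X\,(x,y\notin Y_0\Rightarrow(x\leq y\Rightarrow y\leq x))$, then $\widetilde{Y_0}$ satisfies $\forall x,y\in X_{CpUp(X)}\,(x,y\notin\widetilde{Y_0}\Rightarrow(x\subseteq y\Rightarrow y\subseteq x))$. (c) $(X,\tau)$ is homeomorphic to $(X_{CpUp(X)},\tau_{\mathcal{D}(X)})$, and $(X,\leq)$ is order-isomorphic to $(X_{CpUp(X)},\subseteq)$.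
   Context: A relatively pseudo-complemented (rpc) lattice is a lattice with a binary operation $\rightarrow$ satisfying $a\wedge x\leq b\Leftrightarrow x\leq a\rightarrow b$; it has a greatest element $1$. A ccpBa (contrapositionally complemented pseudo-Boolean algebra) is an algebra $(A,1,0,\vee,\wedge,\rightarrow,\neg,\sim)$ such that $(A,1,0,\vee,\wedge,\rightarrow)$ is a bounded rpc lattice and, for all $a\in A$, $\neg a=a\rightarrow 0$ and $\sim a=a\rightarrow(\neg\neg\sim 1)$. A c$\vee$cpBa is a ccpBa in which $a\vee\sim a=1$ for all $a\in A$. In a poset $(X,\leq)$, an upset is a subset closed upwards, and $\downarrow Z=\{x\in X:\exists y\in Z,\ x\leq y\}$. A Priestley space is a triple $(X,\tau,\leq)$ with $(X,\leq)$ a poset and $\tau$ a compact topology on $X$ such that whenever $x\nleq y$ there is a clopen upset $Y$ with $x\in Y$, $y\notin Y$. An Esakia space is a Priestley space in which $\downarrow U$ is clopen for every clopen $U$. $CpUp(X)$ is the set of clopen upsets of $(X,\tau,\leq)$. For $U,V\in CpUp(X)$: $U\rightarrow V:=X\setminus\downarrow(U\setminus V)$, $\neg U:=U\rightarrow\emptyset$, $\sim X:=Y_0$ and $\sim U:=U\rightarrow Y_0$. In part (1) these operations are taken on $(X_A,\tau_{\mathcal{A}},\subseteq)$ with $Y_0=\sigma(\sim 1)$. For the algebra $\mathcal{D}(X)$ in part (2), $X_{CpUp(X)}$ and $\tau_{\mathcal{D}(X)}$ denote its set of prime filters and the topology on it obtained from $\mathcal{D}(X)$ exactly as $X_A$ and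 $\tau_{\mathcal{A}}$ are obtained from $\mathcal{A}$ in part (1). *)

(* Defs.v *)
From HB Require Import structures.
From mathcomp Require Import all_boot all_order.
From mathcomp Require Import all_classical.
From mathcomp Require Import topology.

Set Implicit Arguments.
Unset Strict Implicit.
Unset Printing Implicit Defensive.

Local Open Scope classical_set_scope.

Record algebra := Algebra {
  car :> Type;
  aone : car;
  azero : car;
  ajoin : car -> car -> car;
  ameet : car -> car -> car;
  aimp : car -> car -> car;
  aneg : car -> car;
  asim : car -> car }.
Arguments aone {a}.
Arguments azero {a}.

Definition ale (A : algebra) (a b : A) : Prop := ameet a b = a.

Definition lattice (A : algebra) : Prop :=
  [/\ commutative (@ajoin A), commutative (@ameet A),
      associative (@ajoin A), associative (@ameet A)
    & (forall a b : A, ajoin a (ameet a b) = a) /\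
      (forall a b : A, ameet a (ajoin a b) = a)].

Definition bounded_rpc_lattice (A : algebra) : Prop :=
  [/\ lattice A,
      forall a : A, ale azero a,
      forall a : A, ale a aone
    & forall a b x : A, ale (ameet a x) b <-> ale x (aimp a b)].

Definition ccpBa (A : algebra) : Prop :=
  [/\ bounded_rpc_lattice A,
      forall a : A, aneg a = aimp a azero
    & forall a : A, asim a = aimp a (aneg (aneg (asim aone)))].

Definition cvcpBa (A : algebra) : Prop :=
  ccpBa A /\ forall a : A, ajoin a (asim a) = aone.

Definition isomorphism (A B : algebra) (f : A -> B) : Prop :=
  bijective f /\
  [/\ f aone = aone /\ f azero = azero,
      {morph f : a b / ajoin a b} /\ {morph f : a b / ameet a b},
      {morph f : a b / aimp a b},
      {morph f : a / aneg a}
    & {morph f : a / asim a}].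

Definition prime_filter (A : algebra) : set (set A) :=
  [set F | [/\ F !=set0 /\ F <> [set: A],
               forall a b, F a -> F b -> F (ameet a b),
               forall a b, F a -> ale a b -> F b
             & forall a b, F (ajoin a b) -> F a \/ F b]].

Arguments prime_filter : clear implicits.

Definition spec (A : algebra) : Type := set_type (prime_filter A).

HB.instance Definition _ (A : algebra) := SubChoice.on (spec A).

Definition sigma (A : algebra) (a : A) : set (spec A) := [set P | val P a].

Definition spec_subbase (A : algebra) : set (set (spec A)) :=
  [set U | (exists a : A, U = sigma a) \/ (exists a, U = ~` sigma a)].

HB.instance Definition _ (A : algebra) :=
  isSubBaseTopological.Build (spec A) (@spec_subbase A) id.

(* Prime filters are ordered by inclusion, see [spec_leP]. *)
HB.instance Definition _ (A : algebra) :=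
  [SubChoice_isSubPOrder of spec A by <: with set_display].

Lemma spec_leP (A : algebra) (P Q : spec A) :
  (P <= Q)%O <-> val P `<=` val Q.
Proof. by rewrite -Order.le_val subsetEset. Qed.

Section Esakia.
Context {d : Order.disp_t} {X : POrderedTopological.type d}.
Implicit Types (x y z : X) (U V Z : set X).

Definition upset U : Prop := forall x y, U x -> (x <= y)%O -> U y.

Definition down Z : set X := [set x | exists2 y, Z y & (x <= y)%O].

Definition clopen_upset : set (set X) := [set U | clopen U /\ upset U].

Definition cofinality_condition Z : Prop :=
  forall x, (forall y, (x <= y)%O -> exists z, (y <= z)%O /\ Z z) -> Z x.

Definition symmetric_outside Z : Prop :=
  forall x y, ~ Z x -> ~ Z y -> (x <= y)%O -> (y <= x)%O.

Definition set_imp U V : set X := ~` down (U `\` V).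

Lemma down_upsetC Z : upset (~` down Z).
Proof.
move=> x y nx xy [z Zz yz]; apply: nx; exists z => //.
exact: Order.POrderTheory.le_trans xy yz.
Qed.

Lemma clopen_upset0 : clopen_upset set0.
Proof. by split=> //; exact: clopen0. Qed.

Lemma clopen_upsetT : clopen_upset setT.
Proof. by split=> //; exact: clopenT. Qed.

Lemma clopen_upsetU U V :
  clopen_upset U -> clopen_upset V -> clopen_upset (U `|` V).
Proof.
move=> [cU uU] [cV uV]; split; first exact: clopenU.
by move=> x y [/uU Ux|/uV Vx] xy; [left; apply: Ux|right; apply: Vx].
Qed.

Lemma clopen_upsetI U V :
  clopen_upset U -> clopen_upset V -> clopen_upset (U `&` V).
Proof.
move=> [cU uU] [cV uV]; split; first exact: clopenI.
by move=> x y [/uU Ux /uV Vx] xy; split; [apply: Ux|apply: Vx].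
Qed.

(* Agreement of the two clauses defining the operation [asim] of [dual] below:
   its value at the whole space is Y0. *)
Lemma set_impT Z : upset Z -> set_imp setT Z = Z.
Proof.
move=> uZ; apply/seteqP; split=> x.
  by move=> nx; apply: contrapT => nZ; apply: nx; exists x => //.
by move=> Zx [y [_ nZy] xy]; apply: nZy; exact: uZ Zx xy.
Qed.

End Esakia.
Arguments clopen_upset {d} X.

Definition priestley_space d (X : POrderedTopological.type d) : Prop :=
  compact [set: X] /\
  forall x y : X, ~ (x <= y)%O -> exists Y, [/\ clopen_upset X Y, Y x & ~ Y y].

Definition esakia_space d (X : POrderedTopological.type d) : Prop :=
  priestley_space X /\ forall U : set X, clopen U -> clopen (down U).

Definition CpUp d (X : POrderedTopological.type d) : Type :=
  set_type (clopen_upset X).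

Definition cpup d (X : POrderedTopological.type d) (U : set X)
  (hU : clopen_upset X U) : CpUp X := exist _ U (mem_set hU).

Lemma clopen_upset_imp d (X : POrderedTopological.type d) (U V : set X) :
  esakia_space X -> clopen_upset X U -> clopen_upset X V ->
  clopen_upset X (set_imp U V).
Proof.
move=> [_ dX] [cU _] [cV _]; split; last exact: down_upsetC.
apply: (clopenC set0); apply: dX.
by rewrite setDE; apply: clopenI => //; apply: (clopenC set0).
Qed.

Section Dual.
Context {d : Order.disp_t} {X : POrderedTopological.type d}.
Variables (hX : esakia_space X) (Y0 : set X) (hY : clopen_upset X Y0).

Let cpup_imp (U V : CpUp X) : CpUp X :=
  cpup (clopen_upset_imp hX (set_valP U) (set_valP V)).

Definition dual : algebra := {|
  car := CpUp X;
  aone := cpup clopen_upsetT;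
  azero := cpup clopen_upset0;
  ajoin U V := cpup (clopen_upsetU (set_valP U) (set_valP V));
  ameet U V := cpup (clopen_upsetI (set_valP U) (set_valP V));
  aimp := cpup_imp;
  aneg U := cpup_imp U (cpup clopen_upset0);
  asim U := cpup_imp U (cpup hY) |}.

End Dual.

Definition homeomorphic (T U : topologicalType) : Prop :=
  exists (f : T -> U) (g : U -> T),
    [/\ cancel f g, cancel g f, continuous f & continuous g].

Definition order_isomorphic d d' (S : porderType d) (T : porderType d') : Prop :=
  exists2 f : S -> T, bijective f & {mono f : x y / (x <= y)%O}.

(* Main.v *)
(** Prime filters are separated by Zorn's lemma, and the sets
    [sigma a `\` sigma b] form a base of the spectrum, whose compactness follows
    by turning an ultrafilter [F] into the prime filter [{a | sigma a \in F}].
    Since [down (sigma a `\` sigma b)] is the complement of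
    [sigma (aimp a b)], a compactness argument shows that the down-set of any
    clopen set is the complement of some [sigma c]: this gives at once the
    Esakia property and the fact that every clopen upset is some [sigma c].
    The cofinality condition on [Y0] says that [Y0] is regular, i.e. equal to
    its double pseudo-complement, which is the ccpBa axiom for [asim].
    Conversely, the canonical map from an Esakia space to its bidual is
    a continuous order embedding with closed and dense range. *)

Require Import Defs.
From mathcomp Require Import all_boot all_order.
From mathcomp Require Import all_classical.
From mathcomp Require Import topology.

Set Implicit Arguments.
Unset Strict Implicit.
Unset Printing Implicit Defensive.

Local Open Scope classical_set_scope.

(** * The order of a lattice given by equations *)

Section Lattice.
Context (A : algebra) (latA : lattice A).
Implicit Types a b c x : A.

Lemma meetxx a : ameet a a = a.
Proof.
have [_ _ _ _ [joinK meetK]] := latA.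
by rewrite -{2}(joinK a a) meetK.
Qed.

Lemma ale_trans b a c : ale a b -> ale b c -> ale a c.
Proof.
have [_ _ _ meetA _] := latA; rewrite /ale => ab bc.
by rewrite -{1}ab -meetA bc.
Qed.

Lemma ale_anti a b : ale a b -> ale b a -> a = b.
Proof.
have [_ meetC _ _ _] := latA; rewrite /ale => ab ba.
by rewrite -ab meetC ba.
Qed.

Lemma ale_meetl a b : ale (ameet a b) a.
Proof.
have [_ meetC _ meetA _] := latA.
by rewrite /ale meetC meetA meetxx.
Qed.

Lemma ale_meetr a b : ale (ameet a b) b.
Proof. by have [_ _ _ meetA _] := latA; rewrite /ale -meetA meetxx. Qed.

Lemma ale_meet c a b : ale c a -> ale c b -> ale c (ameet a b).
Proof.
by have [_ _ _ meetA _] := latA; rewrite /ale meetA => -> ->.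
Qed.

Lemma ale_joinE a b : ale a b <-> ajoin a b = b.
Proof.
have [joinC meetC _ _ [joinK meetK]] := latA; rewrite /ale; split=> [<-|<-].
  by rewrite meetC joinC joinK.
by rewrite meetK.
Qed.

Lemma ale_joinl a b : ale a (ajoin a b).
Proof. by have [_ _ _ _ [_]] := latA; exact. Qed.

Lemma ale_joinr a b : ale b (ajoin a b).
Proof. by have [joinC _ _ _ _] := latA; rewrite joinC; exact: ale_joinl. Qed.

Lemma ale_join c a b : ale a c -> ale b c -> ale (ajoin a b) c.
Proof.
have [_ _ joinA _ _] := latA.
by rewrite !ale_joinE -joinA => ac ->.
Qed.

End Lattice.

(** The improper filter is allowed; properness enters only through an element to be avoided. *)
Definition lattice_filter (A : algebra) : set (set A) :=
  [set F | [/\ F aone,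
               forall a b, F a -> F b -> F (ameet a b)
             & forall a b, F a -> ale a b -> F b]].

(** * Prime filters and the topology of the spectrum *)

Section RelativePseudoComplement.
Context (A : algebra) (rpcA : bounded_rpc_lattice A).
Implicit Types (a b c x : A) (F : set A) (P Q : spec A).

Let latA : lattice A. Proof. by case: rpcA. Qed.

Lemma imp_intro a b x : ale (ameet a x) b -> ale x (aimp a b).
Proof. by case: rpcA => _ _ _ ->. Qed.

Lemma imp_elim a b x : ale x (aimp a b) -> ale (ameet a x) b.
Proof. by case: rpcA => _ _ _ <-. Qed.

Lemma modus_ponens a b : ale (ameet a (aimp a b)) b.
Proof. by apply: imp_elim; exact: meetxx. Qed.

Lemma le_imp a c : ale c (aimp a c).
Proof. by apply: imp_intro; exact: ale_meetr. Qed.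

Lemma imp1E a : aimp aone a = a.
Proof.
have [_ _ le1 _] := rpcA; have [_ meetC _ _ _] := latA.
apply: ale_anti (le_imp _ _) => //.
by have := modus_ponens aone a; rewrite meetC le1.
Qed.

Lemma lattice_filter_up a : lattice_filter [set c | ale a c].
Proof.
split=> /=; first by have [_ _ + _] := rpcA; exact.
  by move=> b c; exact: (ale_meet latA).
by move=> b c; exact: ale_trans.
Qed.

(* By residuation, this is the filter generated by [F] and [a]. *)
Lemma lattice_filter_imp F a :
  lattice_filter F -> lattice_filter [set c | F (aimp a c)].
Proof.
move=> [F1 FI Fle]; split=> /=; first by apply: (Fle aone) => //; exact: le_imp.
  move=> b c Fb Fc; apply: Fle (FI _ _ Fb Fc) _; apply: imp_intro.
  apply: ale_meet => //; apply: ale_trans (modus_ponens a _) => //.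
    apply: ale_meet => //; first exact: ale_meetl.
    by apply: ale_trans (ale_meetr _ _ _) (ale_meetl _ _ _).
  apply: ale_meet => //; first exact: ale_meetl.
  by apply: ale_trans (ale_meetr _ _ _) (ale_meetr _ _ _).
move=> b c Fb bc; apply: Fle Fb _; apply: imp_intro.
by apply: ale_trans bc => //; exact: modus_ponens.
Qed.

(** Residuation turns this into an upper bound for [ajoin a b], checked on [a] and [b]
    separately. *)
Lemma imp_join a b c :
  ale (ameet (aimp a c) (aimp b c)) (aimp (ajoin a b) c).
Proof.
have [_ meetC _ _ _] := latA.
apply: imp_intro; rewrite meetC; apply: imp_elim; apply: ale_join => //.
  by apply: imp_intro; rewrite meetC; apply: imp_elim; exact: ale_meetl.
by apply: imp_intro; rewrite meetC; apply: imp_elim; exact: ale_meetr.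
Qed.

(** A filter [M] maximal among those containing [F] and avoiding [b] is prime: if [x] and [y] lie
    outside [M], then [aimp x b] and [aimp y b] lie in it, so [ajoin x y] in [M] would force [b]. *)
Lemma prime_filter_extension F b : lattice_filter F -> ~ F b ->
  exists P, F `<=` val P /\ ~ val P b.
Proof.
move=> filF nFb.
(* Zorn's lemma also asks for the union of the empty chain to be good; adjoining [F] to [G] covers
   that case. *)
pose good G := lattice_filter (F `|` G) /\ ~ (F `|` G) b.
have [C good_sub chainC|G [[filM nMb] maxG]] := @Zorn_bigcup A good.
  split; last first.
    by move=> [//|[G CG Gb]]; case: (good_sub _ CG) => _; apply; right.
  have in_union G : C G -> F `|` G `<=` F `|` \bigcup_(G in C) G.
    by move=> CG x [Fx|Gx]; [left|right; exists G].
  have [F1 FI Fle] := filF; split; first by left.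
  - move=> x y [Fx|[G CG Gx]] [Fy|[H CH Hy]].
    + by left; exact: FI.
    + have [[_ HI _] _] := good_sub _ CH.
      by apply: (in_union _ CH); apply: HI; [left|right].
    + have [[_ GI _] _] := good_sub _ CG.
      by apply: (in_union _ CG); apply: GI; [right|left].
    + have [GH|HG] := chainC _ _ CG CH.
        have [[_ HI _] _] := good_sub _ CH.
        by apply: (in_union _ CH); apply: HI; right => //; exact: GH.
      have [[_ GI _] _] := good_sub _ CG.
      by apply: (in_union _ CG); apply: GI; right => //; exact: HG.
  - move=> x y [Fx|[G CG Gx]] xy; first by left; exact: Fle xy.
    have [[_ _ Gle] _] := good_sub _ CG.
    by apply: (in_union _ CG); apply: Gle xy; right.
set M := F `|` G in filM nMb; have [M1 MI Mle] := filM.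
have max_imp a : ~ M a -> M (aimp a b).
  move=> nMa; apply: contrapT => nMab.
  have subN : M `<=` [set c | M (aimp a c)].
    by move=> c Mc; apply: Mle Mc _; exact: le_imp.
  (* Otherwise the filter generated by [M] and [a] still avoids [b], yet it contains [a] and so
     properly extends [G]. *)
  apply: (maxG [set c | M (aimp a c)]).
    split; first by move=> c Gc; apply: subN; right.
    move=> sub; apply: nMa; right; apply: sub => /=.
    by apply: Mle M1 _; apply: imp_intro; exact: ale_meetl.
  rewrite /good (_ : F `|` _ = [set c | M (aimp a c)]).
    by split=> //; exact: lattice_filter_imp.
  by apply/setUidPr => c Fc; apply: subN; left.
have primeM : prime_filter A M.
  split=> //; first by split; [exists aone | move=> MT; apply: nMb; rewrite MT].
  move=> x y Mxy; apply: contrapT => /not_orP[/max_imp Mx /max_imp My].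
  apply: nMb; apply: (Mle _ _ _ (modus_ponens (ajoin x y) b)).
  by apply: (MI) => //; apply: Mle (imp_join _ _ _); exact: MI.
exists (exist _ M (mem_set primeM)); split=> //; exact: subsetUl.
Qed.

Lemma prime_separation a b : ~ ale a b -> exists P, val P a /\ ~ val P b.
Proof.
move=> nab.
have [P [sub nPb]] := prime_filter_extension (lattice_filter_up a) nab.
by exists P; split=> //; apply: sub; exact: meetxx.
Qed.

Lemma spec1 P : val P aone.
Proof.
have [[[a Pa] _] _ Ple _] := set_valP P.
by apply: Ple Pa _; have [_ _ + _] := rpcA; exact.
Qed.

Lemma spec0 P : ~ val P azero.
Proof.
have [[_ nT] _ Ple _] := set_valP P.
move=> P0; apply: nT; apply/seteqP; split=> // a _.
by apply: Ple P0 _; have [_ + _ _] := rpcA; exact.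
Qed.

Lemma spec_le P a b : val P a -> ale a b -> val P b.
Proof. by have [_ _ + _] := set_valP P; exact. Qed.

Lemma lattice_filter_spec P : lattice_filter (val P).
Proof. by have [_ PI Ple _] := set_valP P; split=> //; exact: spec1. Qed.

Lemma sigma1 : sigma (@aone A) = setT.
Proof. by apply/seteqP; split=> // P _; exact: spec1. Qed.

Lemma sigma0 : sigma (@azero A) = set0.
Proof. by apply/seteqP; split=> // P /spec0. Qed.

Lemma sigmaI a b : sigma (ameet a b) = sigma a `&` sigma b.
Proof.
apply/seteqP; split=> P; last first.
  by have [_ PI _ _] := set_valP P; move=> [Pa Pb]; exact: PI.
by move=> Pab; split; apply: spec_le Pab _;
  [exact: ale_meetl|exact: ale_meetr].
Qed.

Lemma sigmaU a b : sigma (ajoin a b) = sigma a `|` sigma b.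
Proof.
apply/seteqP; split=> P; first by have [_ _ _] := set_valP P; exact.
by move=> [Pa|Pb]; [apply: spec_le Pa _; exact: ale_joinl
                   |apply: spec_le Pb _; exact: ale_joinr].
Qed.

Lemma sigma_inj : injective (@sigma A).
Proof.
have sub_le a b : sigma a `<=` sigma b -> ale a b.
  by move=> sab; apply: contrapT => /prime_separation[P [/sab]].
by move=> a b sab; apply: ale_anti => //; apply: sub_le; rewrite sab.
Qed.

(* The unqualified [down] is hidden here by that of [classical_sets]. *)
Lemma down_sigmaD a b : Defs.down (sigma a `\` sigma b) = ~` sigma (aimp a b).
Proof.
apply/seteqP; split=> P /=.
  move=> [Q [Qa nQb] /spec_leP PQ] Pab; apply: nQb.
  apply: (spec_le _ (modus_ponens a b)).
  by have [_ QI _ _] := set_valP Q; apply: QI => //; exact: PQ.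
move=> nPab.
(* The filter generated by [val P] and [a] avoids [b] because [P] omits [aimp a b]. *)
have [Q [PQ nQb]] :=
  prime_filter_extension (lattice_filter_imp a (lattice_filter_spec P)) nPab.
exists Q; last first.
  by apply/spec_leP => c Pc; apply: PQ; apply: spec_le Pc _; exact: le_imp.
split=> //; apply: PQ; apply: spec_le (spec1 P) _.
by apply: imp_intro; exact: ale_meetl.
Qed.

Lemma sigma_imp a b : sigma (aimp a b) = set_imp (sigma a) (sigma b).
Proof. by rewrite /set_imp down_sigmaD setCK. Qed.

Lemma upset_sigma a : upset (sigma a).
Proof. by move=> P Q Pa /spec_leP PQ; exact: PQ. Qed.

(** Convergence can be tested on the subbasis, since filters are closed under finite
    intersections. *)
Lemma cvg_spec (F : set_system (spec A)) P : Filter F ->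
  (forall a, val P a -> F (sigma a)) ->
  (forall a, ~ val P a -> F (~` sigma a)) -> F --> P.
Proof.
move=> filF Fin Fout U [B [[D' /= subD' <-] [W D'W WP] BU]].
apply: (filterS BU); apply: (@filterS _ _ _ W); first by move=> Q WQ; exists W.
have [D subD WE] := subD' _ D'W; rewrite -{}WE in WP *.
apply: filter_bigI => V DV; have := WP _ DV.
by have := subD _ DV; rewrite inE => -[[a ->]|[a ->]]; [exact: Fin|exact: Fout].
Qed.

Lemma clopen_sigma a : clopen (sigma a).
Proof.
have sub_open U : spec_subbase U -> open U.
  move=> subU; exists [set U]; last by rewrite bigcup_set1.
  by move=> _ ->; exact: (finI_from1 id subU).
split; first by apply: sub_open; left; exists a.
by rewrite -openC; apply: sub_open; right; exists a.
Qed.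

(** The sets [U] as in the conclusion form a filter, which converges to [P] by [cvg_spec]: take [b]
    to be [azero], or [a] to be [aone], for the two kinds of subbasic sets. *)
Lemma spec_basis (U : set (spec A)) P : nbhs P U ->
  exists a b, [/\ val P a, ~ val P b & sigma a `\` sigma b `<=` U].
Proof.
pose F := [set U | exists a b,
  [/\ val P a, ~ val P b & sigma a `\` sigma b `<=` U]].
have filF : Filter F.
  split=> [|V W [a [b [Pa nPb sV]]] [c [d [Pc nPd sW]]]
           |V W VW [a [b [Pa nPb sV]]]].
  - by exists aone, azero; split=> //; [exact: spec1|exact: spec0].
  - exists (ameet a c), (ajoin b d); rewrite sigmaI sigmaU; split.
    + by have [_ PI _ _] := set_valP P; exact: PI.
    + by have [_ _ _ PU] := set_valP P => /PU[].
    + move=> Q [[Qa Qc] /not_orP[nQb nQd]].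
      by split; [exact: sV|exact: sW].
  - by exists a, b; split=> //; exact: subset_trans VW.
apply: (cvg_spec (F := F)) => a Pa.
  by exists a, azero; rewrite sigma0 setD0; split=> //; exact: spec0.
by exists aone, a; rewrite sigma1 setTD; split=> //; exact: spec1.
Qed.

Lemma compact_spec : compact [set: spec A].
Proof.
rewrite compact_ultra => F ultraF _.
have FP : ProperFilter F := ultra_proper.
pose M := [set a | F (sigma a)].
have primeM : prime_filter A M.
  split; rewrite /M /=.
  - split; first by exists aone; rewrite /= sigma1; exact: filterT.
    move/seteqP => [_ /(_ azero I)]; rewrite /= sigma0.
    exact: filter_not_empty.
  - by move=> a b Fa Fb; rewrite sigmaI; exact: filterI.
  - by move=> a b Fa ab; apply: filterS Fa => P Pa; exact: spec_le ab.
  - move=> a b; rewrite sigmaU => Fab.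
    have [|Fna] := in_ultra_setVsetC (sigma a) ultraF; [by left|right].
    by apply: filterS (filterI Fab Fna) => P [[]].
exists (exist _ M (mem_set primeM)); split=> //; apply: cvg_spec => a //= nFa.
by have [|] := in_ultra_setVsetC (sigma a) ultraF.
Qed.

Lemma priestley_spec : priestley_space (spec A).
Proof.
split; first exact: compact_spec.
move=> P Q /spec_leP /existsNP[a /not_implyP[Pa nQa]].
exists (sigma a); split=> //.
by split; [exact: clopen_sigma|exact: upset_sigma].
Qed.

End RelativePseudoComplement.

(* Compactness in the form: an ideal of sets containing a neighbourhood of each
   point of [K] contains [K]. *)
Lemma compact_ideal (T : topologicalType) (K : set T) (C : set (set T)) :
  compact K -> C set0 -> (forall U V, C U -> C V -> C (U `|` V)) ->
  (forall U V, U `<=` V -> C V -> C U) ->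
  (forall x, K x -> exists2 V, nbhs x V & C V) -> C K.
Proof.
move=> cptK C0 CU Csub CK; apply: contrapT => nCK.
(* If [K] is not in the ideal, these sets form a proper filter; a cluster point of it in [K]
   contradicts the neighbourhood in [C] of that point. *)
pose F := [set W | C (K `\` W)].
have FP : ProperFilter F.
  split; first by rewrite /F /= setD0.
  split; rewrite /F /=; first by rewrite setDT.
    by move=> V W CV CW; rewrite /= setDIr; exact: CU.
  by move=> V W VW; apply: Csub => x [Kx nWx]; split=> // /VW.
have [|x [Kx clx]] := cptK F FP; first by rewrite /F /= setDv.
have [V Vx CV] := CK x Kx.
have [|y [nVy Vy]] := clx (~` V) V _ Vx; last exact: nVy.
by rewrite /F /= setDE setCK; apply: Csub CV; exact: subIsetr.
Qed.

(** * Clopen sets and clopen upsets of the spectrum *)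

Section EsakiaSpectrum.
Context (A : algebra) (rpcA : bounded_rpc_lattice A).

(* A clopen set is a finite union of differences of sets [sigma a], and
   [down_sigmaD] computes the down-set of each of these. *)
Lemma down_clopenE (U : set (spec A)) :
  clopen U -> exists c, Defs.down U = ~` sigma c.
Proof.
move=> [oU cU].
(* The intermediate [W] makes [C] closed under subsets; for [V] equal to [U] it forces [W] to be
   [U]. *)
pose C := [set V | exists W c,
  [/\ V `<=` W, W `<=` U & Defs.down W = ~` sigma c]].
have [|||||W [c [UW WU dW]]] := @compact_ideal _ U C.
- by apply: subclosed_compact cU (compact_spec rpcA) _.
- exists set0, aone; split=> //; rewrite sigma1 // setCT.
  by apply/seteqP; split=> // P [].
- move=> V V' [W [c [VW WU dW]]] [W' [c' [VW' WU' dW']]].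
  exists (W `|` W'), (ameet c c'); split.
  + exact: setUSS.
  + by rewrite subUset.
  + rewrite sigmaI // setCI -dW -dW'; apply/seteqP; split=> P.
      by move=> [Q [WQ|WQ] PQ]; [left|right]; exists Q.
    by move=> [[Q WQ PQ]|[Q WQ PQ]]; exists Q => //; [left|right].
- move=> V V' VV' [W [c [VW WU dW]]]; exists W, c; split=> //.
  exact: subset_trans VW.
- move=> P UP.
  have [a [b [Pa nPb sU]]] := spec_basis rpcA (open_nbhs_nbhs (conj oU UP)).
  exists (sigma a `\` sigma b).
    apply: open_nbhs_nbhs; split=> //; rewrite setDE; apply: openI.
      by case: (clopen_sigma a).
    by rewrite openC; case: (clopen_sigma b).
  exists (sigma a `\` sigma b), (aimp a b); split=> //; exact: down_sigmaD.
by exists c; rewrite -dW; congr Defs.down; apply/seteqP.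
Qed.

Lemma esakia_spec : esakia_space (spec A).
Proof.
split; first exact: priestley_spec.
move=> U /down_clopenE[c ->]; apply: (clopenC set0); exact: clopen_sigma.
Qed.

Lemma clopen_upset_sigma (a : A) : clopen_upset (spec A) (sigma a).
Proof. by split; [exact: clopen_sigma|exact: upset_sigma]. Qed.

(** An upset is the complement of the down-set of its complement, to which [down_clopenE]
    applies. *)
Lemma clopen_upset_specE (U : set (spec A)) :
  clopen_upset (spec A) U -> exists a, U = sigma a.
Proof.
move=> [cU uU]; have [c dUc] := down_clopenE (clopenC set0 cU).
by exists c; rewrite -[LHS](set_impT uU) /set_imp setTD dUc setCK.
Qed.

End EsakiaSpectrum.

(** A clopen upset and its complement are disjoint open sets, so points that cannot be separated are
    comparable both ways. *)
Lemma priestley_hausdorff d (X : POrderedTopological.type d) :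
  priestley_space X -> hausdorff_space X.
Proof.
move=> [_ sep] x y clxy.
have le_cl (u v : X) : cluster (nbhs u) v -> (u <= v)%O.
  move=> cluv; apply: contrapT => nuv.
  have [V [[[oV cV] _] Vu nVv]] := sep _ _ nuv.
  have [||w [Vw]] := cluv V (~` V); last exact.
    exact: open_nbhs_nbhs.
  by apply: open_nbhs_nbhs; split=> //; rewrite openC.
apply/eqP; rewrite Order.POrderTheory.eq_le !le_cl//.
by move=> V W yV xW; rewrite setIC; exact: clxy.
Qed.

(** * The dual algebra of an Esakia space and its bidual *)

Section EsakiaDual.
Context (d : Order.disp_t) (X : POrderedTopological.type d).
Context (hX : esakia_space X) (Y0 : set X) (hY : clopen_upset X Y0).
Let D := dual hX hY.
Implicit Types (U V W : D).

Lemma ale_dual U V : ale U V <-> val U `<=` val V.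
Proof.
split=> [UV|UV]; last by apply: val_inj; exact/setIidPl.
by rewrite -[in X in X `<=` _]UV; exact: subIsetr.
Qed.

Lemma dual_rpc : bounded_rpc_lattice D.
Proof.
split.
- split; [| | | |split].
  + by move=> U V; apply: val_inj; exact: setUC.
  + by move=> U V; apply: val_inj; exact: setIC.
  + by move=> U V W; apply: val_inj; exact: setUA.
  + by move=> U V W; apply: val_inj; exact: setIA.
  + by move=> U V; apply: val_inj; apply/setUidPl; exact: subIsetl.
  + by move=> U V; apply: val_inj; apply/setIidPl; exact: subsetUl.
- by move=> U; apply/ale_dual; exact: sub0set.
- by move=> U; apply/ale_dual; exact: subsetT.
- move=> U V W; rewrite !ale_dual /=; split=> sub x.
    move=> Wx [y [Uy nVy] xy]; apply: nVy; apply: sub; split=> //.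
    by have [_ uW] := set_valP W; exact: uW xy.
  move=> [Ux /sub Wx]; apply: contrapT => nVx; apply: Wx.
  by exists x.
Qed.

(** The double pseudo-complement of [Y0] consists of the points all of whose successors lie below
    some point of [Y0]. *)
Lemma cofinality_condition_sub :
  cofinality_condition Y0 <-> set_imp (set_imp Y0 set0) set0 `<=` Y0.
Proof.
rewrite /set_imp !setD0; split=> [cof x nnx|sub x cofx].
  apply: cof => y xy; apply: contrapT => nz; apply: nnx; exists y => //.
  by move=> [z Yz yz]; apply: nz; exists z.
apply: sub => -[y nYy xy]; apply: nYy.
by have [z [yz Yz]] := cofx y xy; exists z.
Qed.

Lemma dual_asim1 : asim (@aone D) = cpup hY.
Proof. by apply: val_inj; apply: set_impT; case: hY. Qed.

Lemma dual_ccpBa : cofinality_condition Y0 -> ccpBa D.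
Proof.
move=> /cofinality_condition_sub sub; split=> //; first exact: dual_rpc.
(* One inclusion is the cofinality condition; the other holds for any upset. *)
have negneg : aneg (aneg (cpup hY : D)) = cpup hY.
  apply: val_inj; apply/seteqP; split=> //= x Yx [y [nYy _] xy].
  by apply: nYy; exists y => //; split=> //; have [_ uY] := hY; exact: uY xy.
by move=> U; rewrite dual_asim1 negneg.
Qed.

(** If [x] is in neither [U] nor [asim U], some [y] above [x] is in [U] but not in [Y0]. Then [x] is
    not in [Y0] either, so [y <= x] by symmetry and [x] is in [U] after all. *)
Lemma dual_cvcpBa :
  cofinality_condition Y0 -> symmetric_outside Y0 -> cvcpBa D.
Proof.
move=> cof sym; split; first exact: dual_ccpBa.
move=> U; apply: val_inj; apply/seteqP; split=> //= x _.
have [[_ uU] [_ uY]] := (set_valP U, hY).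
have [Ux|nUx] := pselect (val U x); [by left|right].
move=> [y [Uy nYy] xy]; apply: nUx; apply: (uU _ _ Uy).
by apply: sym (xy) => //; move=> Yx; apply: nYy; exact: uY xy.
Qed.

Lemma prime_filter_point (x : X) : prime_filter D [set U : D | val U x].
Proof.
split=> /=.
- split; first by exists (aone : D).
  by move=> /seteqP[_ /(_ (azero : D) I)].
- by [].
- by move=> U V Ux /ale_dual; exact.
- by [].
Qed.

Definition point (x : X) : spec D :=
  exist _ [set U : D | val U x] (mem_set (prime_filter_point x)).

Lemma point_le (x y : X) : (point x <= point y)%O = (x <= y)%O.
Proof.
apply/idP/idP => [/spec_leP sub|xy]; last first.
  by apply/spec_leP => U; have [_ uU] := set_valP U => Ux; exact: uU xy.
apply: contrapT => nxy; have [[_ sep] _] := hX.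
by have [V [hV Vx]] := sep _ _ nxy; apply; exact: (sub (cpup hV)).
Qed.

Lemma point_inj : injective point.
Proof.
move=> x y xy; apply/eqP.
by rewrite Order.POrderTheory.eq_le -!point_le xy Order.POrderTheory.lexx.
Qed.

Lemma point_continuous : continuous point.
Proof.
move=> x; apply: (cvg_spec (A := D)) => U; rewrite /nbhs /= => Ux.
  by have [[oU _] _] := set_valP U; exact: open_nbhs_nbhs.
have [[_ cU] _] := set_valP U.
by apply: open_nbhs_nbhs; split=> //; rewrite openC.
Qed.

(* A basic open set [sigma U `\` sigma V] of the spectrum that misses the closed
   set [range point] has [U] included in [V], hence is empty. *)
Lemma point_surj (P : spec D) : range point P.
Proof.
apply: contrapT => nP.
have closed_range : closed (range point).
  apply: compact_closed (priestley_hausdorff (priestley_spec dual_rpc)) _.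
  apply: continuous_compact; last by case: hX => -[].
  exact/continuous_subspaceT/point_continuous.
have nbhsP : nbhs P (~` range point).
  by apply: open_nbhs_nbhs; split=> //; rewrite openC.
have [U [V [PU nPV sub]]] := spec_basis dual_rpc nbhsP.
apply: nPV; apply: (spec_le PU); apply/ale_dual => x Ux.
by apply: contrapT => nVx; apply: (sub (point x)) => //; exists x.
Qed.

Lemma point_can : exists g, cancel point g /\ cancel g point.
Proof.
have /choice[g gK] : forall P : spec D, exists x, point x = P.
  by move=> P; have [x _ <-] := point_surj P; exists x.
by exists g; split=> // x; apply: point_inj; rewrite gK.
Qed.

(** A continuous bijection from a compact space onto a Hausdorff space is a closed map. *)
Lemma point_homeomorphic : homeomorphic X (spec D).
Proof.
have [g [pK gK]] := point_can; exists point, g; split=> //.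
  exact: point_continuous.
apply/continuous_closedP => C cC.
rewrite (_ : g @^-1` C = point @` C).
  apply: compact_closed (priestley_hausdorff (priestley_spec dual_rpc)) _.
  apply: continuous_compact; first exact/continuous_subspaceT/point_continuous.
  by have [[cptX _] _] := hX; exact: subclosed_compact cC cptX _.
apply/seteqP; split=> [P CgP|_ [x Cx <-]]; first by exists (g P).
by rewrite /= pK.
Qed.

Lemma point_order_isomorphic : order_isomorphic X (spec D).
Proof.
have [g [pK gK]] := point_can.
by exists point; [exists g|move=> x y; rewrite point_le].
Qed.

End EsakiaDual.

(** * The spectrum of a ccpBa and the representation by clopen upsets *)

Section CcpBaSpectrum.
Context (A : algebra) (ccpA : ccpBa A).

Let rpcA : bounded_rpc_lattice A. Proof. by case: ccpA. Qed.

(** This is the axiom for [asim] taken at [aone], as [aimp aone] is the identity. *)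
Lemma asim1_regular : aneg (aneg (asim (@aone A))) = asim aone.
Proof. by have [_ _ asimE] := ccpA; rewrite [RHS]asimE imp1E. Qed.

Lemma sigma_neg (a : A) : sigma (aneg a) = set_imp (sigma a) set0.
Proof.
have [_ anegE _] := ccpA.
by rewrite anegE (sigma_imp rpcA) (sigma0 rpcA).
Qed.

Lemma sigma_sim (a : A) :
  sigma (asim a) = set_imp (sigma a) (sigma (asim aone)).
Proof.
have [_ _ asimE] := ccpA.
by rewrite -sigma_imp // asimE asim1_regular.
Qed.

Lemma cofinality_spec : cofinality_condition (sigma (asim (@aone A))).
Proof.
by apply/cofinality_condition_sub; rewrite -!sigma_neg asim1_regular.
Qed.

(** For [a] in [Q] but not in [P], excluded middle puts [asim a] into [P]; then [Q], lying above [P]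
    and containing [a], would contain [asim aone]. *)
Lemma symmetric_spec :
  cvcpBa A -> symmetric_outside (sigma (asim (@aone A))).
Proof.
move=> [_ em] P Q nP nQ /spec_leP PQ; apply/spec_leP => a Qa.
have : sigma (ajoin a (asim a)) P by rewrite em sigma1.
rewrite sigmaU // sigma_sim => -[//|nd].
by exfalso; apply: nd; exists Q => //; apply/spec_leP.
Qed.

Lemma sigma_isomorphism (hX : esakia_space (spec A))
    (hY : clopen_upset (spec A) (sigma (asim (@aone A)))) :
  isomorphism
    (fun a : A => cpup (clopen_upset_sigma a) : dual hX hY).
Proof.
split; [|split; [split|split| | |]].
- have /choice[g gK] : forall U : dual hX hY, exists a, sigma a = val U.
    move=> U; have [a Ua] := clopen_upset_specE rpcA (set_valP U).
    by exists a; rewrite -Ua.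
  exists g => [a|U]; last by apply: val_inj; exact: gK.
  by apply: (sigma_inj rpcA); rewrite gK.
- by apply: val_inj; exact: sigma1.
- by apply: val_inj; exact: sigma0.
- by move=> a b; apply: val_inj; exact: sigmaU.
- by move=> a b; apply: val_inj; exact: sigmaI.
- by move=> a b; apply: val_inj; exact: sigma_imp.
- by move=> a; apply: val_inj; exact: sigma_neg.
- by move=> a; apply: val_inj; exact: sigma_sim.
Qed.

End CcpBaSpectrum.

Theorem theorem2p12 :
  (forall A : algebra, ccpBa A ->
    let Y0 := sigma (asim (@aone A)) in
    exists (hX : esakia_space (spec A)) (hY : clopen_upset (spec A) Y0),
      [/\ [/\ clopen Y0, cofinality_condition Y0
            & cvcpBa A -> symmetric_outside Y0],
          ccpBa (dual hX hY) /\ (cvcpBa A -> cvcpBa (dual hX hY))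
        & exists Phi : A -> dual hX hY,
            (forall a : A, set_val (Phi a) = sigma a) /\ isomorphism Phi])
  /\
  (forall (d : Order.disp_t) (X : POrderedTopological.type d)
      (hX : esakia_space X) (Y0 : set X) (hY : clopen_upset X Y0),
    cofinality_condition Y0 ->
    let D := dual hX hY in
    let Y1 := sigma (asim (@aone D)) in
    [/\ ccpBa D /\ (symmetric_outside Y0 -> cvcpBa D),
        [/\ esakia_space (spec D), cofinality_condition Y1
          & symmetric_outside Y0 -> symmetric_outside Y1]
      & homeomorphic X (spec D) /\ order_isomorphic X (spec D)]).
Proof.
split=> [A ccpA Y0|d X hX Y0 hY cof D Y1].
  have rpcA : bounded_rpc_lattice A by case: ccpA.
  have cofY : cofinality_condition Y0 by exact: cofinality_spec.
  exists (esakia_spec rpcA), (clopen_upset_sigma _); split.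
  - split=> //; first exact: clopen_sigma.
    exact: symmetric_spec.
  - split; first exact: dual_ccpBa.
    by move=> cvA; apply: dual_cvcpBa => //; exact: symmetric_spec.
  - by exists (fun a => cpup (clopen_upset_sigma a)); split=> //;
      exact: sigma_isomorphism.
(* The results on spectra now apply to [D] itself and give the conditions on [Y1]. *)
have ccpD : ccpBa D by exact: dual_ccpBa.
split.
- by split=> // sym; exact: dual_cvcpBa.
- split; first exact/esakia_spec/dual_rpc.
    exact: cofinality_spec.
  by move=> sym; apply: symmetric_spec => //; exact: dual_cvcpBa.
- by split; [exact: point_homeomorphic|exact: point_order_isomorphic].
Qed.
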